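(* Let $P_1$ be a set of four points in general position in $\mathbb{R}^2$, let $(P_k, L_k)_{k \ge 1}$ be the iterated point-line configuration generated by $P_1$, assume that for every $k\in\mathbb{N}$ no two distinct lines of $L_k$ are parallel, and let $n_k = |P_k|$. Then there exist positive real constants $c_1$ and $c_2$ (not depending on $k$) such that for every $k \in \mathbb{N}$, $$c_1\, 4^{(1.0488^k)} \le n_k \le c_2\, 4^{(4^k)}.$$
   Context: $\mathbb{N}$ denotes the positive integers. General position for four points means no three are collinear. The iterated point-line configuration generated by $P_1$ is defined as follows: $L_1$ is the set of (six) lines through pairs of distinct points of $P_1$. For each $k\ge 1$, $P_{k+1}$ is obtained from $P_k$ by adding every point of the plane that is the intersection of two distinct lines of $L_k$; then $L_{k+1}$ is obtained from $L_k$ by adding the line through each pair of distinct points of $P_{k+1}$. Thus $L_k$ is the set of all lines through two distinct points of $P_k$, and $P_k \subseteq P_{k+1}$, $L_k \subseteq L_{k+1}$. *)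

(* Defs.v *)
From HB Require Import structures.
From mathcomp Require Import all_boot all_order all_algebra finmap.
From mathcomp Require Import all_classical all_reals all_analysis.

Set Implicit Arguments.
Unset Strict Implicit.
Unset Printing Implicit Defensive.
Import Order.TTheory GRing.Theory Num.Theory.
Local Open Scope classical_set_scope.
Local Open Scope ring_scope.

(* Lines are represented as sets of points of the plane [R * R], so that equality
   of lines is equality of sets. [line p q] is a line only when [p <> q]. *)
Definition line (R : realType) (p q : R * R) : set (R * R) :=
  [set x | exists t : R, x = p + t *: (q - p)].

Definition collinear (R : realType) (A : set (R * R)) : Prop :=
  exists a b : R * R, a <> b /\ A `<=` line a b.

Definition general_position (R : realType) (P : set (R * R)) : Prop :=
  forall p q r : R * R, P p -> P q -> P r -> p <> q -> p <> r -> q <> r ->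
    ~ collinear [set p; q; r].

(* Meant for distinct lines of the plane: they are parallel when they do not
   meet. *)
Definition parallel (R : realType) (l m : set (R * R)) : Prop :=
  l `&` m = set0.

Definition lines_through (R : realType) (P : set (R * R)) :
    set (set (R * R)) :=
  [set l | exists p q : R * R, [/\ P p, P q, p <> q & l = line p q]].

Definition intersection_points (R : realType) (L : set (set (R * R))) :
    set (R * R) :=
  [set x | exists l m : set (R * R), [/\ L l, L m, l <> m & (l `&` m) x]].

Definition next_configuration (R : realType)
    (C : set (R * R) * set (set (R * R))) : set (R * R) * set (set (R * R)) :=
  let P := C.1 `|` intersection_points C.2 in (P, C.2 `|` lines_through P).

(* The configuration of index [k], indices starting at 1; the value at
   [k = 0] is irrelevant and coincides with the value at [k = 1]. *)
Definition configuration (R : realType) (P1 : set (R * R)) (k : nat) :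
    set (R * R) * set (set (R * R)) :=
  iter k.-1 (@next_configuration R) (P1, lines_through P1).

Definition config_points (R : realType) (P1 : set (R * R)) (k : nat) :
  set (R * R) := (configuration P1 k).1.

Definition config_lines (R : realType) (P1 : set (R * R)) (k : nat) :
  set (set (R * R)) := (configuration P1 k).2.

(* [fset_set] sends an infinite set to [fset0], so a positive lower bound on
   this number also asserts that the point set is finite. *)
Definition num_points (R : realType) (P1 : set (R * R)) (k : nat) : nat :=
  #|` fset_set (config_points P1 k)|%fset.

(* Main.v *)
Require Import Defs.
From HB Require Import structures.
From mathcomp Require Import all_boot all_order all_algebra finmap.
From mathcomp Require Import all_classical all_reals all_analysis.
From mathcomp Require Import ring lra zify.

Set Implicit Arguments.
Unset Strict Implicit.
Unset Printing Implicit Defensive.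
Import Order.TTheory GRing.Theory Num.Theory.
Local Open Scope classical_set_scope.
Local Open Scope ring_scope.

(** The idea is to read the configuration in the projective coordinates in which
    the four starting points are the frame (1 : 0 : 0), (0 : 1 : 0), (0 : 0 : 1),
    (1 : 1 : 1), and to run von Staudt's arithmetic in it.  Since distinct lines
    of the configuration always meet in the affine plane, no intersection is
    lost at infinity, so every projective construction from the frame really
    takes place: joins are [join_points], intersections are [meet_lines].

    Lower bound.  Say that the number a is present at stage k when the lines
    x = a and y = a of the frame belong to L_k.  If a and b are present at stage
    k, then (a, b) is a point of stage k + 1, and both a + b and a * b are
    present at stage k + 2 ([has_valueD], [has_valueM]).  Writing an integer up
    to n ^ 2 as q * n + r, one sees that if 0, ..., n are present at some stage
    then 0, ..., n ^ 2 are present four stages later ([has_value_natS]).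
    Starting from 0, 1, 2 at stage 5, the integers up to 2 ^ 2 ^ j are present
    at stage 5 + 4 j, and the grid they span gives more than 4 ^ 2 ^ j points
    at stage 6 + 4 j.  So the growth rate of the exponent is at least
    2 ^ (1 / 4) = 1.189..., and 1.0488 leaves room for the rounding of k to a
    multiple of 4 ([ratio_exp_le]).

    Upper bound.  A point of P_(k+1) is either in P_k or determined by four
    points of P_k, so n_(k+1) <= n_k + n_k ^ 4, and 2 n_k <= 4 ^ 4 ^ k follows
    by induction ([config_points_cover]). *)

(** * Lines and the configuration *)

(** Twice the signed area of the triangle p q r. *)
Definition orient (R : realType) (p q r : R * R) : R :=
  (q.1 - p.1) * (r.2 - p.2) - (q.2 - p.2) * (r.1 - p.1).

Lemma line_orient (R : realType) (p q r : R * R) : p <> q ->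
  line p q r <-> orient p q r = 0.
Proof.
rewrite /orient => npq; split=> [[t ->]|].
  by rewrite /= /GRing.scale /=; ring.
case: p q r npq => [p1 p2] [q1 q2] [r1 r2] npq /= det0.
case: (eqVneq q1 p1) => [eq1|ne1]; last first.
  have ne : q1 - p1 != 0 by rewrite subr_eq0.
  exists ((r1 - p1) / (q1 - p1)); rewrite /GRing.scale /=; congr pair => /=.
    by rewrite /GRing.scale /=; field.
  rewrite /GRing.scale /= -[r2](addrNK p2).
  suff -> : r2 - p2 = (r1 - p1) / (q1 - p1) * (q2 - p2) by ring.
  apply: (mulfI ne); rewrite [RHS]mulrC mulrAC divfK //.
  lra.
have ne : q2 - p2 != 0.
  by apply/eqP => /subr0_eq e2; apply: npq; rewrite eq1 e2.
exists ((r2 - p2) / (q2 - p2)); congr pair => /=; last first.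
  by rewrite /GRing.scale /=; field.
rewrite eq1 subrr scaler0 addr0.
move: det0; rewrite eq1 subrr mul0r sub0r => /eqP.
by rewrite oppr_eq0 mulf_eq0 (negbTE ne) /= subr_eq0 => /eqP.
Qed.

Lemma line_determined (R : realType) (p q x y : R * R) : p <> q -> x <> y ->
  line p q x -> line p q y -> line p q = line x y.
Proof.
move=> npq nxy lx ly; apply/seteqP; split=> z; last first.
  move: lx ly => [t ->] [s ->] [u ->].
  exists (t + u * (s - t)); congr pair => /=; rewrite /GRing.scale /=; ring.
move=> lz; apply/(line_orient _ nxy).
move: lx ly lz => [t ->] [s ->] [u ->].
by rewrite /orient /= /GRing.scale /=; ring.
Qed.

Lemma config_linesE (R : realType) (P : set (R * R)) k :
  config_lines P k = lines_through (config_points P k).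
Proof.
rewrite /config_lines /config_points /configuration.
elim: k.-1 => [//|j IH] /=; rewrite IH.
apply/setUidPr => l [p [q [Pp Pq npq ->]]].
by exists p, q; split => //; left.
Qed.

(** Stages 0 and 1 coincide, hence the restriction to positive [k]. *)
Lemma config_pointsS (R : realType) (P : set (R * R)) k : (0 < k)%N ->
  config_points P k.+1 = config_points P k `|`
    intersection_points (config_lines P k).
Proof. by case: k => // k _. Qed.

Lemma config_points_sub (R : realType) (P : set (R * R)) j k : (j <= k)%N ->
  config_points P j `<=` config_points P k.
Proof.
move=> /subnK <-; elim: (k - j)%N => [//|i IH]; rewrite addSn.
case: (posnP (i + j)%N) => [ij0|ij]; last first.
  by rewrite config_pointsS // => x /IH Px; left.
by move: IH; rewrite ij0.
Qed.

Lemma config_lines_sub (R : realType) (P : set (R * R)) j k : (j <= k)%N ->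
  config_lines P j `<=` config_lines P k.
Proof.
move=> jk; rewrite !config_linesE => l [p [q [Pp Pq npq ->]]].
by exists p, q; split => //; apply: (config_points_sub jk).
Qed.

(** Two distinct lines have at most one common point, so an intersection point is
    a function of the two pairs of points that span the lines. *)
Lemma intersection_points_cover (R : realType) (P : set (R * R))
    (s : seq (R * R)) : P `<=` [set` s] ->
  exists t : seq (R * R), size t = (size s ^ 4)%N /\
    intersection_points (lines_through P) `<=` [set` t].
Proof.
move=> Ps; pose pairs := [seq (p, q) | p <- s, q <- s].
pose meet (pq rs : (R * R) * (R * R)) :=
  xget 0 (line pq.1 pq.2 `&` line rs.1 rs.2).
exists [seq meet pq rs | pq <- pairs, rs <- pairs]; split.
  by rewrite !size_allpairs; lia.
move=> x [l [m [[p [q [Pp Pq npq ->]]] [r [v [Pr Pv nrv ->]]] nlm [lx mx]]]].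
have pairsP y z : P y -> P z -> (y, z) \in pairs.
  by move=> /Ps Py /Ps Pz; exact: (allpairs_f pair Py Pz).
suff -> : x = meet (p, q) (r, v).
  exact: (allpairs_f meet (pairsP _ _ Pp Pq) (pairsP _ _ Pr Pv)).
rewrite /meet /=; case: xgetP => [y -> [ly my]|/(_ x)]; last by case.
apply: contrapT => nxy; apply: nlm.
exact: etrans (line_determined npq nxy lx ly)
  (esym (line_determined nrv nxy mx my)).
Qed.

(** The factor 2 makes the induction close: if n <= m and 2 m <= M then
    2 (m + m ^ 4) <= (2 m) ^ 4 <= M ^ 4. *)
Lemma config_points_cover (R : realType) (P : set (R * R)) (s : seq (R * R)) k :
  P `<=` [set` s] -> size s = 4%N -> (0 < k)%N ->
  exists t : seq (R * R), config_points P k `<=` [set` t] /\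
    (2 * size t <= 4 ^ 4 ^ k)%N.
Proof.
move=> Ps s4; elim: k => // -[_ _|k IH _]; first by exists s; rewrite s4.
have [//|t [Pt ht]] := IH.
have [t' [st' It']] := intersection_points_cover Pt.
exists (t ++ t'); split.
  rewrite config_pointsS // config_linesE => x /= [/Pt|/It'] /=;
    by rewrite mem_cat => ->; rewrite ?orbT.
rewrite size_cat st' (expnSr 4 k.+1) (expnM 4 (4 ^ k.+1) 4).
apply: (@leq_trans ((2 * size t) ^ 4)%N); last by rewrite leq_exp2r.
rewrite expnMn mulnDr.
have : (size t <= size t ^ 4)%N.
  by case: (size t) => // n; rewrite expnS leq_pmulr // expn_gt0.
lia.
Qed.

(** * Vectors of homogeneous coordinates *)

(** Vectors stand both for points and for lines of the projective plane: [dot]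
    vanishes exactly when a point lies on a line, and [cross] is the line joining
    two points or the point common to two lines. *)

Section Vectors.
Variable R : realType.
Implicit Types u v w l m : R * R * R.

Definition dot u v : R := u.1.1 * v.1.1 + u.1.2 * v.1.2 + u.2 * v.2.

Definition cross u v : R * R * R :=
  (u.1.2 * v.2 - u.2 * v.1.2, u.2 * v.1.1 - u.1.1 * v.2,
   u.1.1 * v.1.2 - u.1.2 * v.1.1).

Definition det3 u v w : R := dot (cross u v) w.

Lemma triple_eq0 (x y z : R) :
  (x, y, z) = 0 :> R * R * R -> [/\ x = 0, y = 0 & z = 0].
Proof. by case. Qed.

Lemma triple_neq0 (u : R * R * R) : u <> 0 ->
  [\/ u.1.1 != 0, u.1.2 != 0 | u.2 != 0].
Proof.
case: u => [[x y] z] /= nu.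
case: (eqVneq x 0) => [x0|]; last by constructor 1.
case: (eqVneq y 0) => [y0|]; last by constructor 2.
case: (eqVneq z 0) => [z0|]; last by constructor 3.
by case: nu; rewrite x0 y0 z0.
Qed.

Lemma dot_self_eq0 u : dot u u = 0 -> u = 0.
Proof.
case: u => [[x y] z]; rewrite /dot /= => uu0.
have [x0 y0 z0] : [/\ x = 0, y = 0 & z = 0] by split; nra.
by rewrite x0 y0 z0.
Qed.

(** Three points of a common projective line are dependent: [det3 u v w *: l] is
    a combination of vectors with coefficients [dot l u], [dot l v], [dot l w]. *)
Lemma det3_orthogonal l u v w : l <> 0 ->
  dot l u = 0 -> dot l v = 0 -> dot l w = 0 -> det3 u v w = 0.
Proof.
move=> /triple_neq0 l0 lu lv lw.
pose n := dot l u *: cross v w + dot l v *: cross w u + dot l w *: cross u v.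
have n0 : n = 0 by rewrite /n lu lv lw !scale0r !addr0.
have expand : [/\ l.1.1 * det3 u v w = n.1.1, l.1.2 * det3 u v w = n.1.2
    & l.2 * det3 u v w = n.2].
  by split; rewrite /n /det3 /dot /cross /= /GRing.scale /=; ring.
move: expand; rewrite n0 => -[/= e1 e2 e3].
by case: l0 => /mulfI; apply; rewrite mulr0.
Qed.

(** A meet is unique up to scaling: a vector orthogonal to [l] and [m] is equal to
    its projection on their cross product [n], by the triple product identity for
    [cross (cross n w) n]. *)
Lemma orthogonal_proportional l m u v : cross l m <> 0 -> u <> 0 ->
  dot l u = 0 -> dot m u = 0 -> dot l v = 0 -> dot m v = 0 ->
  exists t : R, v = t *: u.
Proof.
move=> n0 u0 lu mu lv mv; pose n := cross l m.
have nn0 : dot n n != 0 by apply/eqP => /dot_self_eq0.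
have proj w : dot l w = 0 -> dot m w = 0 -> w = (dot n w / dot n n) *: n.
  move=> lw mw.
  have nw0 : cross n w = 0.
    have -> : cross n w = dot l w *: m - dot m w *: l.
      by congr (_, _, _); rewrite /n /dot /cross /= /GRing.scale /=; ring.
    by rewrite lw mw !scale0r subrr.
  have : dot n n *: w = dot n w *: n + cross (cross n w) n.
    by case: (w) => [[? ?] ?]; congr (_, _, _);
      rewrite /dot /cross /= /GRing.scale /=; ring.
  rewrite nw0 (_ : cross 0 n = 0) ?addr0; last first.
    by congr (_, _, _); rewrite /=; ring.
  by rewrite mulrC -scalerA => <-; rewrite scalerA mulVf // scale1r.
have nu0 : dot n u != 0.
  apply/eqP => nu; apply: u0.
  by rewrite (proj _ lu mu) nu mul0r scale0r.
have nE : n = (dot n n / dot n u) *: u.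
  rewrite [X in _ *: X](proj _ lu mu) scalerA.
  by rewrite -mulrA (mulrA _^-1) mulVf // mul1r divff // scale1r.
by exists (dot n v / dot n n * (dot n n / dot n u)); rewrite -scalerA -nE -proj.
Qed.

End Vectors.

Lemma orient_neq0 (R : realType) (P : set (R * R)) (p q r : R * R) :
  general_position P -> P p -> P q -> P r -> p <> q -> p <> r -> q <> r ->
  orient p q r != 0.
Proof.
move=> genP Pp Pq Pr npq npr nqr; apply/eqP => pqr0.
apply: (genP p q r) => //; exists p, q; split => // x [[->|->]|->] /=;
  apply/(line_orient _ npq) => //; rewrite /orient; ring.
Qed.

(** * Projective coordinates with respect to the starting points *)

Section Frame.
Variables (R : realType) (P : set (R * R)) (p1 p2 p3 p4 : R * R).
Hypotheses (Pp1 : P p1) (Pp2 : P p2) (Pp3 : P p3) (Pp4 : P p4).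
Hypotheses (o123 : orient p1 p2 p3 != 0) (o423 : orient p4 p2 p3 != 0)
  (o143 : orient p1 p4 p3 != 0) (o124 : orient p1 p2 p4 != 0).
Hypothesis meets : forall k : nat, (1 <= k)%N ->
  forall l m : set (R * R), config_lines P k l -> config_lines P k m ->
    l <> m -> ~ parallel l m.
Implicit Types (p q r : R * R) (u v l m : R * R * R).

(** Barycentric coordinates relative to the triangle p1 p2 p3, each divided by the
    corresponding coordinate of p4, so that p1, p2, p3 have coordinates
    proportional to the basis vectors and p4 has coordinates (1, 1, 1). *)
Definition coords p : R * R * R :=
  (orient p p2 p3 / orient p4 p2 p3, orient p1 p p3 / orient p1 p4 p3,
   orient p1 p2 p / orient p1 p2 p4).

(** [coords] is the restriction of a linear map to the plane of height 1, hence it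
    multiplies [orient] by the determinant of this map. *)
Lemma det3_coords p q r : det3 (coords p) (coords q) (coords r) =
  orient p1 p2 p3 ^+ 2 /
    (orient p4 p2 p3 * orient p1 p4 p3 * orient p1 p2 p4) * orient p q r.
Proof.
rewrite /coords !invfM; move: (_^-1) (_^-1) (_^-1) => a b c.
rewrite /det3 /dot /cross /orient /=; ring.
Qed.

Lemma det3_coords_eq0 p q r :
  det3 (coords p) (coords q) (coords r) = 0 -> orient p q r = 0.
Proof.
rewrite det3_coords => /eqP; rewrite mulf_eq0 => /orP[|/eqP //].
by rewrite mulf_eq0 invr_eq0 expf_eq0 !mulf_eq0 (negbTE o123) (negbTE o423)
  (negbTE o143) (negbTE o124).
Qed.

(** Otherwise every triangle with vertex [p] would be flat. *)
Lemma coords_neq0 p : coords p <> 0.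
Proof.
move=> p0; have : orient p (p + (1, 0)) (p + (0, 1)) = 0.
  apply: det3_coords_eq0; rewrite p0 /det3 /dot /cross /=; ring.
by move: p0 => _; rewrite /orient /=; lra.
Qed.

Lemma coords_inj p q u (s t : R) :
  coords p = s *: u -> coords q = t *: u -> p = q.
Proof.
move=> pu qu; have pq r : orient p q r = 0.
  apply: det3_coords_eq0; rewrite pu qu /det3 /dot /cross /= /GRing.scale /=.
  ring.
have := (pq (p + (1, 0)), pq (p + (0, 1))); rewrite /orient /=.
case: p q {pu qu pq} => [x y] [x' y'] /= [e1 e2].
by congr pair; lra.
Qed.

Lemma dot_coords_line l p q r : p <> q -> line p q r ->
  dot l (coords p) = 0 -> dot l (coords q) = 0 -> dot l (coords r) = 0.
Proof.
move=> npq [t ->] lp lq.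
have -> : dot l (coords (p + t *: (q - p))) =
    (1 - t) * dot l (coords p) + t * dot l (coords q).
  rewrite /coords; move: (_^-1) (_^-1) (_^-1) => a b c.
  rewrite /dot /orient /= /GRing.scale /=; ring.
by rewrite lp lq; ring.
Qed.

(** Only points of the affine plane have coordinates of the form [coords p], so
    this excludes the projective points at infinity. *)
Definition has_point k u := exists2 p, config_points P k p &
  exists2 t : R, t != 0 & coords p = t *: u.

Definition has_line k l := config_lines P k [set p | dot l (coords p) = 0].

Lemma dotZr l u (t : R) : dot l (t *: u) = t * dot l u.
Proof. by rewrite /dot /= /GRing.scale /=; ring. Qed.

Lemma has_point_sub j k u : (j <= k)%N -> has_point j u -> has_point k u.
Proof.
by move=> jk [p Pp pu]; exists p => //; apply: (config_points_sub jk).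
Qed.

Lemma has_line_sub j k l : (j <= k)%N -> has_line j l -> has_line k l.
Proof. by move=> jk; apply: config_lines_sub. Qed.

(** The set of zeros of [l] on the affine plane is exactly the line spanned by the
    two points: a third zero is dependent on them by [det3_orthogonal]. *)
Lemma join_points k u v l : has_point k u -> has_point k v ->
  cross u v <> 0 -> l <> 0 -> dot l u = 0 -> dot l v = 0 -> has_line k l.
Proof.
move=> [p Pp [t t0 pu]] [q Pq [s s0 qv]] nuv l0 lu lv.
have lp : dot l (coords p) = 0 by rewrite pu dotZr lu mulr0.
have lq : dot l (coords q) = 0 by rewrite qv dotZr lv mulr0.
have npq : p <> q.
  move=> epq; apply: nuv; have -> : u = (t^-1 * s) *: v.
    by rewrite -scalerA -qv -epq pu scalerA mulVf // scale1r.
  by congr (_, _, _); rewrite /= /GRing.scale /=; ring.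
rewrite /has_line config_linesE; exists p, q; split => //.
apply/seteqP; split=> r /=; last by move/dot_coords_line; apply.
move=> lr; apply/(line_orient _ npq)/det3_coords_eq0.
exact: det3_orthogonal lp lq lr.
Qed.

(** This is where the absence of parallel lines is used: the projective point
    common to the two lines is then represented by a point of the affine plane. *)
Lemma meet_lines k l m u : (0 < k)%N -> has_line k l -> has_line k m ->
  cross l m <> 0 -> u <> 0 -> dot l u = 0 -> dot m u = 0 ->
  has_point k.+1 u.
Proof.
move=> k0 Ll Lm nlm u0 lu mu.
have proportional_u p : dot l (coords p) = 0 -> dot m (coords p) = 0 ->
    exists2 t : R, t != 0 & coords p = t *: u.
  move=> lp mp; have [t pu] := orthogonal_proportional nlm u0 lu mu lp mp.
  exists t => //; apply/eqP => t0; apply: (@coords_neq0 p).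
  by rewrite pu t0 scale0r.
(* Otherwise two distinct points of this line would both be proportional to u. *)
have nLlm : [set p | dot l (coords p) = 0] <> [set p | dot m (coords p) = 0].
  move=> elm; have := Ll; rewrite /has_line config_linesE.
  move=> [p [q [Pp Pq npq epq]]].
  have on r : line p q r -> exists2 t : R, t != 0 & coords r = t *: u.
    move=> pqr; apply: proportional_u.
      by have : [set p | dot l (coords p) = 0] r by rewrite epq.
    by have : [set p | dot m (coords p) = 0] r by rewrite -elm epq.
  have [|t _ pu] := on p; first by apply/(line_orient _ npq);
    rewrite /orient; ring.
  have [|s _ qu] := on q; first by apply/(line_orient _ npq);
    rewrite /orient; ring.
  exact: npq (coords_inj pu qu).
have [p [lp mp]] : exists p, ([set p | dot l (coords p) = 0] `&`
    [set p | dot m (coords p) = 0]) p.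
  by apply/set0P/eqP; apply: meets Ll Lm nLlm.
exists p; last exact: proportional_u.
rewrite config_pointsS //; right.
by exists [set q | dot l (coords q) = 0], [set q | dot m (coords q) = 0].
Qed.

(** * Von Staudt constructions *)

Lemma has_point_e1 k : has_point k (1, 0, 0).
Proof.
exists p1; first by apply: (@config_points_sub _ _ 0).
exists (orient p1 p2 p3 / orient p4 p2 p3).
  by rewrite mulf_neq0 // invr_eq0.
by rewrite /coords; congr (_, _, _); rewrite /= /GRing.scale /= /orient; ring.
Qed.

Lemma has_point_e2 k : has_point k (0, 1, 0).
Proof.
exists p2; first by apply: (@config_points_sub _ _ 0).
exists (orient p1 p2 p3 / orient p1 p4 p3).
  by rewrite mulf_neq0 // invr_eq0.
by rewrite /coords; congr (_, _, _); rewrite /= /GRing.scale /= /orient; ring.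
Qed.

Lemma has_point_e3 k : has_point k (0, 0, 1).
Proof.
exists p3; first by apply: (@config_points_sub _ _ 0).
exists (orient p1 p2 p3 / orient p1 p2 p4).
  by rewrite mulf_neq0 // invr_eq0.
by rewrite /coords; congr (_, _, _); rewrite /= /GRing.scale /= /orient; ring.
Qed.

Lemma has_point_unit k : has_point k (1, 1, 1).
Proof.
exists p4; first by apply: (@config_points_sub _ _ 0).
exists 1; first exact: oner_neq0.
by rewrite /coords !divff // scale1r.
Qed.

(** Side conditions of [join_points] and [meet_lines] on explicit vectors. *)
Ltac incidence := try (by move=> /triple_eq0 /= -[? ? ?]; lra);
  try (by rewrite /dot /=; ring).

(** The lines x = a and y = a of the frame, in which p3 is the origin and p1, p2
    are the points at infinity of the axes. *)
Definition has_value k (a : R) :=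
  has_line k (1, 0, - a) /\ has_line k (0, 1, - a).

Lemma has_value_sub j k a : (j <= k)%N -> has_value j a -> has_value k a.
Proof. by move=> jk [? ?]; split; apply: has_line_sub jk _. Qed.

Lemma has_line_vertical k a b : has_point k (a, b, 1) ->
  has_line k (1, 0, - a).
Proof.
by move=> /join_points /(_ (has_point_e2 k)); apply; incidence.
Qed.

Lemma has_line_horizontal k a b : has_point k (a, b, 1) ->
  has_line k (0, 1, - b).
Proof.
by move=> /join_points /(_ (has_point_e1 k)); apply; incidence.
Qed.

Lemma has_point_grid k a b : (0 < k)%N -> has_value k a -> has_value k b ->
  has_point k.+1 (a, b, 1).
Proof.
by move=> k0 [va _] [_ hb]; apply: (meet_lines k0 va hb); incidence.
Qed.

Lemma has_value0 k : has_value k 0.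
Proof.
split; first exact: has_line_vertical (has_point_e3 k).
exact: has_line_horizontal (has_point_e3 k).
Qed.

Lemma has_value1 k : has_value k 1.
Proof.
split; first exact: has_line_vertical (has_point_unit k).
exact: has_line_horizontal (has_point_unit k).
Qed.

(** The direction of x + y = 1, obtained as the intersection of this line with the
    line joining p1 and p2, which is at infinity in the frame. *)
Lemma has_point_antidiagonal k : (3 <= k)%N -> has_point k (1, -1, 0).
Proof.
move=> k3; apply: (has_point_sub k3).
have inf : has_line 2 (0, 0, 1).
  by apply: (join_points (has_point_e1 2) (has_point_e2 2)); incidence.
have anti : has_line 2 (1, 1, -1).
  have p10 := @has_point_grid 1 1 0 isT (has_value1 1) (has_value0 1).
  have p01 := @has_point_grid 1 0 1 isT (has_value0 1) (has_value1 1).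
  by apply: (join_points p10 p01); incidence.
by apply: (meet_lines _ inf anti); incidence.
Qed.

(** The line x + y = a + b joins the grid point (a, b) to the antidiagonal
    direction; it cuts both axes at a + b. *)
Lemma has_valueD k a b : (2 <= k)%N -> has_value k a -> has_value k b ->
  has_value k.+2 (a + b).
Proof.
move=> k2 va vb; have k0 : (0 < k)%N by lia.
have anti : has_line k.+1 (1, 1, - (a + b)).
  have k3 : (3 <= k.+1)%N by [].
  by apply: (join_points (has_point_grid k0 va vb)
    (has_point_antidiagonal k3)); incidence.
have [x0 y0] := has_value0 k.+1.
split.
  apply: (@has_line_vertical _ _ 0).
  by apply: (meet_lines _ anti y0); incidence.
apply: (@has_line_horizontal _ 0).
by apply: (meet_lines _ anti x0); incidence.
Qed.

(** The line y = b x joins the origin to (1, b), and meets x = a at height a b;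
    the vertical line comes from the mirror image of this construction. *)
Lemma has_valueM k a b : (0 < k)%N -> has_value k a -> has_value k b ->
  has_value k.+2 (a * b).
Proof.
move=> k0 va vb; have [xa ya] := has_value_sub (leqnSn k) va.
have p1b := has_point_grid k0 (has_value1 k) vb.
have pb1 := has_point_grid k0 vb (has_value1 k).
have slope : has_line k.+1 (b, -1, 0).
  by apply: (join_points p1b (has_point_e3 _)); incidence.
have slope' : has_line k.+1 (1, - b, 0).
  by apply: (join_points pb1 (has_point_e3 _)); incidence.
split.
  apply: (@has_line_vertical _ _ a).
  by apply: (meet_lines _ ya slope'); incidence.
apply: (@has_line_horizontal _ a).
by apply: (meet_lines _ xa slope); incidence.
Qed.

(** Euclidean division by [n]: quotient and remainder are at most [n], so one
    product and one sum, of two stages each, suffice. *)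
Lemma has_value_natS k n : (2 <= k)%N -> (0 < n)%N ->
  (forall i, (i <= n)%N -> has_value k i%:R) ->
  forall i, (i <= n ^ 2)%N -> has_value k.+4 i%:R.
Proof.
move=> k2 n0 vk i ile; rewrite (divn_eq i n) natrD natrM.
apply: has_valueD; first by lia.
  apply: has_valueM; [by lia| |exact: vk].
  by apply: vk; rewrite -(leq_pmul2r n0) (leq_trans (leq_divM _ _)).
apply: (@has_value_sub k); first by lia.
by apply: vk; apply: ltnW; rewrite ltn_mod.
Qed.

(** Stage 5 is reached by 2 = 1 + 1, and each squaring takes four stages. *)
Lemma has_value_nat j i : (i <= 2 ^ 2 ^ j)%N -> has_value (5 + 4 * j) i%:R.
Proof.
elim: j i => [|j IH] i.
  rewrite expn0 expn1 muln0 addn0.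
  case: i => [_|[_|[_|//]]]; [exact: has_value0|exact: has_value1|].
  rewrite (natrD _ 1 1).
  apply: (@has_value_sub 4) => //.
  by apply: has_valueD => //; exact: has_value1.
rewrite mulnS addnCA expnSr expnM => ile.
by apply: (has_value_natS _ _ IH); [lia|rewrite expn_gt0|].
Qed.

Lemma leq_num_points_grid k n : (0 < k)%N -> finite_set (config_points P k.+1) ->
  (forall i, (i < n)%N -> has_value k i%:R) -> (n ^ 2 <= num_points P k.+1)%N.
Proof.
move=> k0 fin vk.
have gridP (i : 'I_n * 'I_n) : exists p, config_points P k.+1 p /\
    exists2 t : R, t != 0 & coords p = t *: ((i.1%:R, i.2%:R, 1) : R * R * R).
  have [p Pp pt] := has_point_grid k0 (vk _ (ltn_ord i.1)) (vk _ (ltn_ord i.2)).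
  by exists p.
have [f fP] := choice gridP.
have f_inj : injective f.
  move=> i i' ff'; have [_ [t t0 ft]] := fP i; have [_ [t' _ ft']] := fP i'.
  move: ft'; rewrite -ff' ft => -[].
  rewrite /GRing.scale /= !mulr1 => e1 e2 et; rewrite -et in e1 e2.
  case: i i' {ff' ft} e1 e2 => [i1 i2] [i1' i2'] /= /(mulfI t0) e1.
  move=> /(mulfI t0) e2.
  by congr pair; apply: val_inj; apply/eqP; rewrite -(eqr_nat R) ?e1 ?e2.
rewrite /num_points; set S := fset_set _.
have sub : {subset [seq f i | i <- enum {: 'I_n * 'I_n}] <= S}.
  move=> _ /mapP[i _ ->]; rewrite /S in_fset_set // inE.
  by have [] := fP i.
have := uniq_leq_size _ sub.
rewrite map_inj_uniq // enum_uniq size_map -cardE card_prod card_ord.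
by move=> /(_ isT).
Qed.

End Frame.

(** * Numerical bounds and conclusion *)

(** The ratio to the power 4 is at most 1.1 ^ 2 = 1.21 < 2, so the right-hand side
    grows faster from [k] to [k + 4]; the added 1 absorbs the ten initial values,
    for which the truncated quotient is 0. *)
Lemma ratio_exp_le (R : realType) k :
  (10488 / 10000) ^+ k <= (2 ^ ((k - 6) %/ 4))%:R + 1 :> R.
Proof.
have : 1 <= 10488 / 10000 :> R by lra.
have : 10488 / 10000 <= 105 / 100 :> R by lra.
have : (10488 / 10000) ^+ 2 <= 11 / 10 :> R by lra.
move: (10488 / 10000) => r r2 r_le r1; have r0 : 0 <= r by exact: le_trans r1.
have r4 : r ^+ 4 <= 121 / 100.
  have -> : r ^+ 4 = r ^+ 2 * r ^+ 2 by rewrite -exprD.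
  have -> : 121 / 100 = (11 / 10) * (11 / 10) :> R by lra.
  by rewrite ler_pM // exprn_ge0.
have [m] := ubnP k; elim: m k => // m IH k km.
case: (ltnP k 10) => k10.
  rewrite divn_small ?expn0; last by lia.
  apply: (@le_trans _ _ (r ^+ 9)); first by apply: ler_weXn2l.
  have -> : r ^+ 9 = r ^+ 4 * r ^+ 4 * r by rewrite -!exprD -exprSr.
  have r8 : r ^+ 4 * r ^+ 4 <= 121 / 100 * (121 / 100).
    by rewrite ler_pM // exprn_ge0.
  apply: (@le_trans _ _ (121 / 100 * (121 / 100) * (105 / 100))); last by lra.
  by rewrite ler_pM // mulr_ge0 // exprn_ge0.
have {}IH := IH (k - 4)%N; rewrite -(subnK (leq_trans (isT : 4 <= 10)%N k10)).
have -> : ((k - 4 + 4 - 6) %/ 4 = ((k - 4 - 6) %/ 4).+1)%N by lia.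
rewrite exprD expnS natrM.
have /IH : (k - 4 < m)%N by lia.
have : 1 <= (2 ^ ((k - 4 - 6) %/ 4))%:R :> R by rewrite ler1n expn_gt0.
have : 0 <= r ^+ (k - 4) by rewrite exprn_ge0.
have : 0 <= r ^+ 4 by rewrite exprn_ge0.
move: (r ^+ (k - 4)) (r ^+ 4) r4 ((2 ^ _)%:R) => x y y_le f y0 x0 f1 x_le.
have : x * y <= (f + 1) * (121 / 100) by rewrite ler_pM.
lra.
Qed.

Lemma card4_points (T : choiceType) (P : set T) : (P #= `I_4)%card ->
  exists a b c d : T, uniq [:: a; b; c; d] /\ P = [set` [:: a; b; c; d]].
Proof.
move=> P4; have finP : finite_set P by exists 4%N.
have := card_fset_set P4; have := fset_uniq (fset_set P).
have : P = [set` enum_fset (fset_set P)] by rewrite -[LHS](fset_setK finP).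
move: (enum_fset _) => [|a [|b [|c [|d [|? ?]]]]] // PE u _.
by exists a, b, c, d.
Qed.

Theorem theorem9 (R : realType) (P1 : set (R * R))
  (card_P1 : (P1 #= `I_4)%card)
  (gen_P1 : general_position P1)
  (no_parallel : forall k : nat, (1 <= k)%N ->
    forall l m : set (R * R), config_lines P1 k l -> config_lines P1 k m ->
      l <> m -> ~ parallel l m) :
  exists c1 c2 : R, [/\ 0 < c1, 0 < c2 &
    forall k : nat, (1 <= k)%N ->
      c1 * (4 `^ ((10488 / 10000) ^+ k)) <= (num_points P1 k)%:R
      /\ (num_points P1 k)%:R <= c2 * 4 ^+ (4 ^ k)%N].
Proof.
have [p1 [p2 [p3 [p4 [p_uniq P1E]]]]] := card4_points card_P1.
have cover k : (0 < k)%N -> exists t : seq (R * R),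
    config_points P1 k `<=` [set` t] /\ (2 * size t <= 4 ^ 4 ^ k)%N.
  move=> k0.
  apply: (@config_points_cover _ _ [:: p1; p2; p3; p4]) => //.
  by rewrite P1E.
have fin k : (0 < k)%N -> finite_set (config_points P1 k).
  by move=> /cover[t [Pt _]]; apply: sub_finite_set Pt (finite_seq t).
have lower k : (0 < k)%N -> (4 ^ 2 ^ ((k - 6) %/ 4) <= num_points P1 k)%N.
  move=> k0.
  have mono j : (0 < j <= k)%N -> (num_points P1 j <= num_points P1 k)%N.
    move=> /andP[j0 jk]; apply: fsubset_leq_card.
    have := config_points_sub (P := P1) jk.
    by rewrite (fset_set_sub (fin _ j0) (fin _ k0)).
  case: (ltnP k 6) => k6.
    rewrite divn_small; last by lia.
    apply: leq_trans (mono 1%N _); last by [].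
    by rewrite /num_points (card_fset_set card_P1).
  set j := ((k - 6) %/ 4)%N.
  apply: leq_trans (mono (5 + 4 * j).+1 _); last by rewrite /j; lia.
  apply: (@leq_trans ((2 ^ 2 ^ j).+1 ^ 2)%N).
    by rewrite (_ : 4 = 2 ^ 2)%N // -expnM mulnC expnM leq_exp2r // ltnW.
  have memP p : p \in [:: p1; p2; p3; p4] -> P1 p by rewrite P1E.
  move: p_uniq; rewrite /= !inE !negb_or !andbT -!andbA.
  move=> /and5P[/eqP n12 /eqP n13 /eqP n14 /eqP n23 /andP[/eqP n24 /eqP n34]].
  have [h1 h2 h3 h4] : [/\ P1 p1, P1 p2, P1 p3 & P1 p4].
    by split; apply: memP; rewrite !inE eqxx ?orbT.
  have o p q r : P1 p -> P1 q -> P1 r -> p <> q -> p <> r -> q <> r ->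
    orient p q r != 0 by exact: orient_neq0.
  have o123 : orient p1 p2 p3 != 0 by apply: o.
  have o423 : orient p4 p2 p3 != 0 by apply: o => //; exact: nesym.
  have o143 : orient p1 p4 p3 != 0 by apply: o => //; exact: nesym.
  have o124 : orient p1 p2 p4 != 0 by apply: o.
  apply: (leq_num_points_grid o123 o423 o143 o124) => //.
    exact: fin.
  move=> i ij.
  by apply: (has_value_nat h1 h2 h3 h4).
(* The factor 1 / 4 compensates for the added 1 in [ratio_exp_le]. *)
exists (1 / 4), 1; split => [||k k0]; [lra|lra|split].
  set r : R := 10488 / 10000.
  have step : 4 `^ (r ^+ k) <= (4 ^ (2 ^ ((k - 6) %/ 4)).+1)%:R :> R.
    rewrite natrX -(@powR_mulrn _ 4) // ler_powR ?ler1n //.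
    by rewrite -natr1; exact: ratio_exp_le.
  have := lower k k0; rewrite -(ler_nat R) => low.
  move: step; rewrite expnS natrM; lra.
have [t [Pt st]] := cover _ k0.
have nt : (num_points P1 k <= size t)%N.
  apply: uniq_leq_size; first exact: fset_uniq.
  by move=> x; rewrite in_fset_set ?inE; [move/Pt|exact: fin].
rewrite mul1r -natrX ler_nat; lia.
Qed.
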